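(* Let $X$ be a complex Banach space and let $A:D(A)\subset X\to X$ be the generator of a quasi-compact $C_0$-semigroup $(e^{tA})_{t\ge0}$ on $X$. Assume that $(e^{tA})_{t\ge0}$ belongs to the Crandall-Pazy class with parameter $\alpha\in(0,1]$. Let $B:D(B)\subset X\to X$ be a linear operator such that $B$ is $\theta$-subordinate to $A$ with $0<\theta<\alpha\le1$, and $Be^{tA}$ is compact on $X$ for all $t>0$. Assume that $A+B$ generates a strongly continuous semigroup $(e^{t(A+B)})_{t\ge0}$ on $X$. Then $(e^{t(A+B)})_{t\ge0}$ is quasi-compact.
   Context: A $C_0$-semigroup $(T(t))_{t\ge0}$ on $X$ with generator $A$ is in the Crandall-Pazy class with parameter $\alpha\in(0,1]$ if it is immediately differentiable (i.e. $t\mapsto T(t)x$ is differentiable on $(0,\infty)$ for every $x\in X$; equivalently $T(t)X\subset D(A)$ for all $t>0$) and $\|AT(t)\|_{\mathcal L(X)}=O(t^{-1/\alpha})$ as $t\to0^+$. A linear operator $B:D(B)\to X$ is $\theta$-subordinate to $A$ (with $0\le\theta<1$) if $D(A)\subseteq D(B)$ and there is a constant $c>0$ such that $\|Bx\|\le c\,\|Ax\|^{\theta}\|x\|^{1-\theta}$ for all $x\in D(A)$. The operator $A+B$ has domain $D(A+B)=D(A)$. A $C_0$-semigroup $(T(t))_{t\ge0}$ on $X$ is quasi-compact if $\lim_{t\to\infty}\inf\{\|T(t)-K\|_{\mathcal L(X)} : K\in\mathcal L(X),\ K \text{ compact}\}=0$. *)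

(* Defs.v *)
From Stdlib Require Import Reals.
From Coquelicot Require Import Coquelicot.

Open Scope R_scope.

(** Written over the Stdlib reals with Coquelicot.  A complex Banach space is a
    [CompleteNormedModule C_AbsRing]; its norm is [R]-valued, and real scalars
    act through [RtoC].  An element of L(X) is a map satisfying Coquelicot's
    [is_linear], which includes boundedness. *)

(** An unbounded operator.  [ap] is total; its values outside [dom] carry no
    meaning and are never used. *)
Record operator (X : CompleteNormedModule C_AbsRing) := Operator {
  dom : X -> Prop;
  ap : X -> X }.

Arguments Operator {X} dom ap.
Arguments dom {X} o x.
Arguments ap {X} o x.

Definition is_linear_operator {X : CompleteNormedModule C_AbsRing}
    (A : operator X) : Prop :=
  dom A zero /\
  (forall x y, dom A x -> dom A y ->
     dom A (plus x y) /\ ap A (plus x y) = plus (ap A x) (ap A y)) /\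
  (forall (k : C_AbsRing) x, dom A x ->
     dom A (scal k x) /\ ap A (scal k x) = scal k (ap A x)).

(** The sum [A + B] with domain D(A), meant for D(A) contained in D(B). *)
Definition perturbed {X : CompleteNormedModule C_AbsRing}
    (A B : operator X) : operator X :=
  Operator (dom A) (fun x => plus (ap A x) (ap B x)).

(** Semigroups are indexed by [R]; only times [0 <= t] are meaningful. *)
Definition is_C0_semigroup {X : CompleteNormedModule C_AbsRing}
    (T : R -> X -> X) : Prop :=
  (forall t, 0 <= t -> is_linear (T t)) /\
  (forall x, T 0 x = x) /\
  (forall s t x, 0 <= s -> 0 <= t -> T (s + t) x = T s (T t x)) /\
  (forall x, filterlim (fun t => T t x) (at_right 0) (locally x)).

(** The equivalence determines both the domain and the values of [A]. *)
Definition is_generator {X : CompleteNormedModule C_AbsRing}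
    (A : operator X) (T : R -> X -> X) : Prop :=
  is_C0_semigroup T /\
  forall x y : X,
    (dom A x /\ ap A x = y) <->
    filterlim (fun h : R => scal (RtoC (/ h)) (minus (T h x) x))
      (at_right 0) (locally y).

(** Valued in [Rbar]: it is [p_infty] for an unbounded linear map. *)
Definition opnorm {X : CompleteNormedModule C_AbsRing} (L : X -> X) : Rbar :=
  Lub_Rbar (fun r => exists x : X, norm x <= 1 /\ r = norm (L x)).

Definition immediately_differentiable {X : CompleteNormedModule C_AbsRing}
    (T : R -> X -> X) : Prop :=
  forall (x : X) (t : R), 0 < t ->
    exists y : X,
      filterlim (fun h : R => scal (RtoC (/ h)) (minus (T (t + h) x) (T t x)))
        (locally' 0) (locally y).

(** For a semigroup [T] with generator [A].  Immediate differentiability puts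
    the range of [T t] inside [dom A] for [t > 0], so that the composite below
    only sees meaningful values of [ap A]. *)
Definition crandall_pazy {X : CompleteNormedModule C_AbsRing}
    (A : operator X) (T : R -> X -> X) (alpha : R) : Prop :=
  0 < alpha <= 1 /\
  immediately_differentiable T /\
  exists M : R,
    at_right 0 (fun t =>
      Rbar_le (opnorm (fun x => ap A (T t x)))
              (Finite (M * Rpower t (- (1 / alpha))))).

(** Real power [a ^ p] of a nonnegative base.  [Rpower 0 p] is [1] for every
    [p], hence the case split; [0 ^ 0 = 1] and [0 ^ p = 0] for [p > 0]. *)
Definition rpow (a p : R) : R :=
  if Rlt_dec 0 a then Rpower a p
  else if Req_EM_T p 0 then 1 else 0.

Definition subordinate {X : CompleteNormedModule C_AbsRing}
    (B A : operator X) (theta : R) : Prop :=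
  0 <= theta < 1 /\
  (forall x, dom A x -> dom B x) /\
  exists c : R, 0 < c /\
    forall x, dom A x ->
      norm (ap B x) <= c * rpow (norm (ap A x)) theta * rpow (norm x) (1 - theta).

Definition compact_operator {X : CompleteNormedModule C_AbsRing}
    (K : X -> X) : Prop :=
  is_linear K /\
  forall u : nat -> X, (exists M : R, forall n, norm (u n) <= M) ->
    exists phi : nat -> nat, (forall n, (phi n < phi (S n))%nat) /\
      exists y : X, filterlim (fun n => K (u (phi n))) eventually (locally y).

(** The infimum is over a nonempty set of nonnegative reals when [L] is in
    L(X), so that [real] then loses nothing. *)
Definition dist_to_compact {X : CompleteNormedModule C_AbsRing}
    (L : X -> X) : R :=
  real (Glb_Rbar (fun r => exists K : X -> X,
    compact_operator K /\ opnorm (fun x => minus (L x) (K x)) = Finite r)).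

Definition quasi_compact {X : CompleteNormedModule C_AbsRing}
    (T : R -> X -> X) : Prop :=
  is_lim (fun t => dist_to_compact (T t)) p_infty 0.

(* Main.v *)
Require Import Defs.
From Stdlib Require Import Reals Lra Lia List Classical IndefiniteDescription.
From Coquelicot Require Import Coquelicot.

(** Write T for the semigroup of A and S for that of A + B.  Quasi-compactness
    passes from T to S because S(t) - T(t) lies at distance 0 from the compact
    operators for every t > 0 ([difference_near_compact]): adding compact
    approximants of T(t) and of S(t) - T(t) gives one of S(t).

    Classically S(t) - T(t) is the integral over (0, t) of S(t - s) B T(s), whose
    integrand is compact for each s and has norm O(s^(-theta/alpha)), because
    subordination and the Crandall-Pazy estimate give
    |B T(s) x| <= c |A T(s) x|^theta |T(s) x|^(1 - theta).  The exponent exceeds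
    -1 as theta < alpha, so the singularity at s = 0 is integrable.  The proof
    below carries this out without integrals, replacing each of them by a finite
    telescoping sum.

    - For fixed s > 0, [first_order_difference] shows
      |(S(h) - T(h)) T(s) - h B T(s)| = o(h) in operator norm.  Pointwise this is
      the definition of the generators.  It is uniform on the unit ball because
      A T(s) maps it into a subset of D(A) that is bounded for the graph norm, on
      which S(h) - 1 and T(h) - 1 are O(h), and B T(s) maps it into a relatively compact set, on
      which S(h) tends to 1 uniformly.

    - With h = t / n,
      (S(t) - T(t)) T(s) = sum over k of S(t - (k+1)h) (S(h) - T(h)) T(s) T(kh).
      Replacing S(h) - T(h) by its first order term changes the sum by o(1) and
      leaves a finite sum of compact operators of total norm O(t |B T(s)|)
      ([difference_telescoped]).

    - Taking t = s gives |(S(s) - T(s)) T(s)| = O(s^(1 - theta/alpha)).  Since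
      S(t - 2s) T(2s) - S(t - s) T(s) = - S(t - 2s) (S(s) - T(s)) T(s), summing
      along s = t/2, t/4, t/8 and so on is a geometric series, whence
      |S(t) - T(t)| = O(t^(1 - theta/alpha)) ([difference_vanishes]).

    - Finally S(t) - T(t) = S(t-s) (S(s) - T(s)) + (S(t-s) - T(t-s)) T(s), where
      the first term is small in norm for small s and the second is at distance
      0 from the compact operators.

    Local boundedness of semigroups, needed throughout, rests on the uniform
    boundedness principle, which is proved here by a gliding hump. *)

Local Notation Banach := (CompleteNormedModule C_AbsRing).
Local Notation "h *: x" := (scal (RtoC h) x) (at level 40, left associativity).

(** * A decision procedure for real linear combinations *)

Inductive lincomb :=
| LVar (n : nat)
| LZero
| LPlus (e f : lincomb)
| LOpp (e : lincomb)
| LMinus (e f : lincomb)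
| LScal (r : R) (e : lincomb).

Fixpoint lc_eval {X : Banach} (env : list X) (e : lincomb) : X :=
  match e with
  | LVar n => nth n env zero
  | LZero => zero
  | LPlus e f => plus (lc_eval env e) (lc_eval env f)
  | LOpp e => opp (lc_eval env e)
  | LMinus e f => minus (lc_eval env e) (lc_eval env f)
  | LScal r e => r *: lc_eval env e
  end.

(** The normal form of an expression is its function of coefficients, extended
    by 0 beyond the environment, so that [lc_sum] never has to compare lengths. *)
Fixpoint lc_coef (e : lincomb) (i : nat) : R :=
  match e with
  | LVar n => if Nat.eqb n i then 1 else 0
  | LZero => 0
  | LPlus e f => lc_coef e i + lc_coef f i
  | LOpp e => - lc_coef e i
  | LMinus e f => lc_coef e i - lc_coef f i
  | LScal r e => r * lc_coef e i
  end.

Fixpoint lc_sum {X : Banach} (env : list X) (c : nat -> R) : X :=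
  match env with
  | nil => zero
  | cons x env => plus (c O *: x) (lc_sum env (fun i => c (S i)))
  end.

Lemma rscal_plus {X : Banach} (r s : R) (x : X) : (r + s) *: x = plus (r *: x) (s *: x).
Proof. rewrite RtoC_plus. apply (scal_distr_r (RtoC r : C_AbsRing)). Qed.

Lemma rscal_mult {X : Banach} (r s : R) (x : X) : (r * s) *: x = r *: (s *: x).
Proof. rewrite RtoC_mult. symmetry; apply (scal_assoc (RtoC r : C_AbsRing)). Qed.

Lemma rscal_0 {X : Banach} (x : X) : 0 *: x = zero.
Proof. apply (scal_zero_l (K := C_AbsRing)). Qed.

Lemma rscal_1 {X : Banach} (x : X) : 1 *: x = x.
Proof. apply (scal_one (K := C_AbsRing)). Qed.

Lemma rscal_opp1 {X : Banach} (x : X) : opp x = (- 1) *: x.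
Proof.
  replace (- 1) with (Ropp 1) by ring. rewrite RtoC_opp. symmetry.
  exact (scal_opp_one (K := C_AbsRing) (V := X) x).
Qed.

Lemma lc_sum_ext {X : Banach} (env : list X) (c d : nat -> R) :
  (forall i, c i = d i) -> lc_sum env c = lc_sum env d.
Proof.
  revert c d. induction env as [|x env IH]; intros c d H; [reflexivity|].
  cbn. rewrite (H O). f_equal. apply IH. intros i. apply H.
Qed.

Lemma lc_sum_plus {X : Banach} (env : list X) (c d : nat -> R) :
  lc_sum env (fun i => c i + d i) = plus (lc_sum env c) (lc_sum env d).
Proof.
  revert c d. induction env as [|x env IH]; intros c d; cbn.
  - symmetry. apply plus_zero_l.
  - rewrite rscal_plus, IH, <- !plus_assoc. f_equal.
    rewrite !plus_assoc. f_equal. apply plus_comm.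
Qed.

Lemma lc_sum_scal {X : Banach} (env : list X) (r : R) (c : nat -> R) :
  lc_sum env (fun i => r * c i) = r *: lc_sum env c.
Proof.
  revert c. induction env as [|x env IH]; intros c; cbn.
  - symmetry. exact (scal_zero_r (K := C_AbsRing) (V := X) (RtoC r)).
  - rewrite rscal_mult, IH. symmetry. exact (scal_distr_l (K := C_AbsRing) (V := X) (RtoC r) _ _).
Qed.

Lemma lc_sum_zero {X : Banach} (env : list X) (c : nat -> R) :
  (forall i, c i = 0) -> lc_sum env c = zero.
Proof.
  intros H. rewrite (lc_sum_ext env c (fun i => 0 * 0)) by (intros; rewrite H; ring).
  rewrite (lc_sum_scal env 0 (fun _ => 0)). apply rscal_0.
Qed.

Lemma lc_sum_var {X : Banach} (env : list X) (n : nat) :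
  lc_sum env (fun i => if Nat.eqb n i then 1 else 0) = nth n env zero.
Proof.
  revert n. induction env as [|x env IH]; intros [|n]; cbn; try reflexivity.
  - rewrite rscal_1, lc_sum_zero by reflexivity. apply plus_zero_r.
  - rewrite rscal_0, IH. apply plus_zero_l.
Qed.

Lemma lc_eval_sum {X : Banach} (env : list X) (e : lincomb) :
  lc_eval env e = lc_sum env (lc_coef e).
Proof.
  induction e as [n| |e IHe f IHf|e IHe|e IHe f IHf|r e IHe]; cbn.
  - symmetry. apply lc_sum_var.
  - symmetry. now apply lc_sum_zero.
  - now rewrite IHe, IHf, lc_sum_plus.
  - rewrite rscal_opp1, IHe, <- lc_sum_scal. apply lc_sum_ext. intros; ring.
  - unfold minus. rewrite rscal_opp1, IHe, IHf, <- lc_sum_scal.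
    change (plus (lc_sum env (lc_coef e)) (lc_sum env (fun i => - 1 * lc_coef f i)) =
      lc_sum env (fun i => lc_coef e i - lc_coef f i)).
    rewrite <- lc_sum_plus. apply lc_sum_ext. intros; ring.
  - now rewrite IHe, lc_sum_scal.
Qed.

Ltac lc_index a env :=
  lazymatch env with
  | cons a _ => constr:(O)
  | cons _ ?env => let n := lc_index a env in constr:(S n)
  end.

Ltac lc_add a env :=
  let rec mem l :=
    lazymatch l with
    | nil => constr:(cons a env)
    | cons a _ => env
    | cons _ ?l => mem l
    end in mem env.

Ltac lc_atoms e env :=
  lazymatch e with
  | plus ?a ?b => let env := lc_atoms a env in lc_atoms b env
  | minus ?a ?b => let env := lc_atoms a env in lc_atoms b env
  | opp ?a => lc_atoms a env
  | scal (RtoC _) ?a => lc_atoms a env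
  | zero => env
  | _ => lc_add e env
  end.

Ltac lc_reify e env :=
  lazymatch e with
  | plus ?a ?b =>
      let a := lc_reify a env in let b := lc_reify b env in constr:(LPlus a b)
  | minus ?a ?b =>
      let a := lc_reify a env in let b := lc_reify b env in constr:(LMinus a b)
  | opp ?a => let a := lc_reify a env in constr:(LOpp a)
  | scal (RtoC ?r) ?a => let a := lc_reify a env in constr:(LScal r a)
  | zero => constr:(LZero)
  | _ => let n := lc_index e env in constr:(LVar n)
  end.

Ltac lc_compare :=
  lazymatch goal with
  | |- plus _ _ = plus _ _ =>
      apply f_equal2; [apply (f_equal (fun r => r *: _)); try field | lc_compare]
  | |- _ => reflexivity
  end.

(** Proves an equality between linear combinations with real coefficients by
    comparing coefficients; coefficients that are not closed by [field] are
    left as goals. *)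
Ltac vector :=
  lazymatch goal with
  | |- @eq ?T ?u ?v =>
      let X := match T with context [?X] =>
        lazymatch type of X with CompleteNormedModule.type C_AbsRing => X end end in
      let env := lc_atoms u (@nil (CompleteNormedModule.sort C_AbsRing X)) in
      let env := lc_atoms v env in
      let u := lc_reify u env in
      let v := lc_reify v env in
      change (lc_eval (X := X) env u = lc_eval (X := X) env v);
      rewrite !(lc_eval_sum (X := X));
      cbn [lc_sum lc_coef Nat.eqb];
      lc_compare
  end.

(** * Norms and bounded operators *)

(** The next facts are general ones about normed modules.  Stated for a complete
    module they carry the structure instances that occur in the goals below,
    which makes them usable for syntactic rewriting. *)
Lemma norm_null {X : Banach} : norm (zero : X) = 0.
Proof. apply (norm_zero (V := X)). Qed.

Lemma norm_neg {X : Banach} (x : X) : norm (opp x) = norm x.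
Proof. apply (norm_opp (V := X)). Qed.

Lemma norm_minus_sym {X : Banach} (x y : X) : norm (minus x y) = norm (minus y x).
Proof. rewrite <- norm_neg. f_equal. vector. Qed.

Lemma norm_minus_le {X : Banach} (x y : X) : norm (minus x y) <= norm x + norm y.
Proof. rewrite <- (norm_neg y). apply (norm_triangle (V := X)). Qed.

Lemma norm_minus_trans {X : Banach} (y x z : X) :
  norm (minus x z) <= norm (minus x y) + norm (minus y z).
Proof. rewrite (minus_trans y x z). apply (norm_triangle (V := X)). Qed.

Lemma rscal_inv {X : Banach} (r : R) (x : X) : r <> 0 -> r *: (/ r *: x) = x.
Proof.
  intros Hr. vector. assumption.
Qed.

Lemma norm_rscal_le {X : Banach} (r : R) (x : X) : norm (r *: x) <= Rabs r * norm x.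
Proof. rewrite <- Cmod_R. exact (norm_scal (V := X) (RtoC r : C_AbsRing) x). Qed.

(** The structure only provides the inequality [<=]; applied to [/ r] it yields
    the reverse one. *)
Lemma norm_rscal {X : Banach} (r : R) (x : X) : norm (r *: x) = Rabs r * norm x.
Proof.
  apply Rle_antisym; [apply norm_rscal_le|].
  destruct (Req_dec r 0) as [->|Hr].
  - rewrite Rabs_R0, Rmult_0_l. apply norm_ge_0.
  - pose proof (norm_rscal_le (/ r) (r *: x)) as H.
    rewrite <- (Rinv_inv r) in H at 2. rewrite rscal_inv in H by now apply Rinv_neq_0_compat.
    rewrite Rabs_inv in H.
    apply Rmult_le_reg_l with (/ Rabs r).
    + now apply Rinv_0_lt_compat, Rabs_pos_lt.
    + rewrite <- Rmult_assoc, Rinv_l, Rmult_1_l by now apply Rabs_no_R0. exact H.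
Qed.

Lemma norm_rscal_pos {X : Banach} (r : R) (x : X) :
  0 <= r -> norm (r *: x) = r * norm x.
Proof. intros Hr. now rewrite norm_rscal, Rabs_pos_eq. Qed.

Lemma lin_scal {X : Banach} (L : X -> X) : is_linear L ->
  forall (k : C_AbsRing) x, L (scal k x) = scal k (L x).
Proof. intros HL k x. exact (linear_scal L HL k x). Qed.

Lemma lin_rscal {X : Banach} (L : X -> X) : is_linear L ->
  forall (r : R) x, L (r *: x) = r *: L x.
Proof. intros HL r x. exact (linear_scal L HL (RtoC r) x). Qed.

Lemma lin_plus {X : Banach} (L : X -> X) : is_linear L ->
  forall x y, L (plus x y) = plus (L x) (L y).
Proof. intros HL x y. exact (linear_plus L HL x y). Qed.

Lemma lin_minus {X : Banach} (L : X -> X) : is_linear L ->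
  forall x y, L (minus x y) = minus (L x) (L y).
Proof. intros HL x y. exact (linear_minus L x y HL). Qed.

Lemma linear_bound {X : Banach} (L : X -> X) : is_linear L ->
  exists M, 0 < M /\ forall x, norm (L x) <= M * norm x.
Proof. intros HL. exact (linear_norm _ HL). Qed.

Lemma bound_of_unit_ball {X : Banach} (L : X -> X) (r : R) :
  (forall k x, L (scal k x) = scal k (L x)) ->
  (forall x, norm x <= 1 -> norm (L x) <= r) ->
  forall x, norm (L x) <= r * norm x.
Proof.
  intros Lscal Hr x.
  destruct (Req_dec (norm x) 0) as [H0|H0].
  - assert (E : x = 0 *: x) by (rewrite rscal_0; now apply (norm_eq_zero (V := X))).
    rewrite H0, E, Lscal, norm_rscal, Rabs_R0. lra.
  - pose proof (norm_ge_0 x) as Hp.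
    rewrite <- (rscal_inv (norm x) x) at 1 by assumption.
    rewrite Lscal, norm_rscal_pos, Rmult_comm by assumption.
    apply Rmult_le_compat_r; [assumption|]. apply Hr.
    rewrite norm_rscal_pos, Rinv_l by (try apply Rlt_le, Rinv_0_lt_compat; lra). lra.
Qed.

(** The gliding hump needs vectors at which the operator norm is nearly attained;
    any factor above 1/2 would do in place of 3/4. *)
Lemma near_norming_vector {X : Banach} (L : X -> X) : is_linear L ->
  exists (N : R) (x : X), 0 <= N /\ (forall y, norm (L y) <= N * norm y) /\
    norm x <= 1 /\ 3 / 4 * N <= norm (L x).
Proof.
  intros HL. destruct (linear_norm _ HL) as [M [HM Mb]].
  destruct (completeness (fun r => exists x : X, norm x <= 1 /\ r = norm (L x)))
    as [N [Nub Nlub]].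
  - exists M. intros r [x [Hx ->]]. eapply Rle_trans; [apply Mb|].
    rewrite <- (Rmult_1_r M) at 2. apply Rmult_le_compat_l; lra.
  - exists (norm (L zero)), zero. rewrite norm_null. split; [lra|reflexivity].
  - assert (HN : 0 <= N).
    { apply Rle_trans with (norm (L zero)); [apply norm_ge_0|].
      apply Nub. exists zero. rewrite norm_null. split; [lra|reflexivity]. }
    assert (Nb : forall y, norm (L y) <= N * norm y).
    { apply bound_of_unit_ball; [now apply lin_scal|].
      intros x Hx. apply Nub. now exists x. }
    destruct (Req_dec N 0) as [H0|HN0].
    + exists N, zero. split; [assumption|split; [assumption|split]].
      * rewrite norm_null. lra.
      * rewrite H0, Rmult_0_r. apply (norm_ge_0 (V := X)).
    + destruct (classic (exists x : X, norm x <= 1 /\ 3 / 4 * N <= norm (L x)))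
        as [[x Hx]|Hno]; [now exists N, x|].
      exfalso. assert (N <= 3 / 4 * N); [|lra].
      apply Nlub. intros r [x [Hx ->]].
      destruct (Rle_dec (norm (L x)) (3 / 4 * N)) as [|Hgt]; [assumption|].
      exfalso. apply Hno. exists x. split; [assumption|lra].
Qed.

(** * The uniform boundedness principle *)

Lemma cauchy_sequence_limit {X : Banach} (u : nat -> X) :
  (forall e, 0 < e -> exists N, forall m n, (N <= m)%nat -> (N <= n)%nat ->
     norm (minus (u n) (u m)) < e) ->
  exists y, filterlim u eventually (locally y).
Proof.
  intros H. apply (filterlim_locally_cauchy (U := X)).
  intros eps. destruct (H eps (cond_pos eps)) as [N HN].
  exists (fun n => (N <= n)%nat). split; [now exists N|].
  intros m n Hm Hn. apply (norm_compat1 (V := X)). now apply HN.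
Qed.

Lemma norm_limit {X : Banach} {I : Type} {F : (I -> Prop) -> Prop} {FF : Filter F}
  (f : I -> X) (y : X) :
  filterlim f F (locally y) <-> forall e, 0 < e -> F (fun i => norm (minus (f i) y) < e).
Proof.
  pose proof (filterlim_locally_ball_norm (F := F) (U := X) f y) as E. split.
  - intros H e He. exact (proj1 E H (mkposreal e He)).
  - intros H. apply E. intros eps. apply (H eps (cond_pos eps)).
Qed.

Lemma norm_limit_le {X : Banach} (u : nat -> X) (x y : X) (r : R) (N : nat) :
  filterlim u eventually (locally y) ->
  (forall n, (N <= n)%nat -> norm (minus (u n) x) <= r) -> norm (minus y x) <= r.
Proof.
  intros Hu Hr. apply Rnot_lt_le. intros Hlt.
  destruct (proj1 (norm_limit u y) Hu (norm (minus y x) - r)) as [M HM]; [lra|].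
  specialize (HM (N + M)%nat ltac:(lia)). specialize (Hr (N + M)%nat ltac:(lia)).
  pose proof (norm_minus_trans (u (N + M)%nat) y x) as Ht.
  rewrite (norm_minus_sym y (u _)) in Ht. lra.
Qed.

(** Gliding hump, without Baire category.  If the norms are unbounded, pick [L k]
    of norm N k >= 4^k.  Build a Cauchy sequence x k with steps of size 3^-k such
    that [L k] is at least 3/4 * 3^-k * N k on x (k+1).  The limit differs from
    x (k+1) by at most 1/2 * 3^-k, so [L k] is still at least 1/4 * (4/3)^k there,
    against pointwise boundedness. *)
Lemma uniform_boundedness {X : Banach} {I : Type} (L : I -> X -> X) :
  (forall i, is_linear (L i)) ->
  (forall x, exists C, forall i, norm (L i x) <= C) ->
  exists C, forall i x, norm (L i x) <= C * norm x.
Proof.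
  intros Llin Lpt. apply NNPP. intros Hno.
  assert (Hk : forall k : nat, exists p : I * X * R,
    let '(i, w, N) := p in 4 ^ k <= N /\ (forall y, norm (L i y) <= N * norm y) /\
      norm w <= (/ 3) ^ k /\ 3 / 4 * ((/ 3) ^ k * N) <= norm (L i w)).
  { intros k.
    assert (Hi : exists (i : I) (x : X), 4 ^ k * norm x < norm (L i x)).
    { apply NNPP. intros Hall. apply Hno. exists (4 ^ k). intros i x.
      apply Rnot_lt_le. intros Hlt. apply Hall. now exists i, x. }
    destruct Hi as [i [x0 Hx0]].
    destruct (near_norming_vector (L i) (Llin i)) as [N [x [HN [Nb [Hx Hbig]]]]].
    assert (H3 : 0 < (/ 3) ^ k) by (apply pow_lt; lra).
    exists (i, (/ 3) ^ k *: x, N). split; [|split; [assumption|split]].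
    - apply Rnot_lt_le. intros Hlt. specialize (Nb x0).
      pose proof (norm_ge_0 x0). nra.
    - rewrite norm_rscal_pos by lra. nra.
    - rewrite (lin_rscal _ (Llin i)), norm_rscal_pos by lra. nra. }
  destruct (functional_choice _ Hk) as [p Hp]. clear Hk Hno.
  set (i := fun k => fst (fst (p k))). set (w := fun k => snd (fst (p k))).
  set (N := fun k => snd (p k)).
  assert (HN : forall k, 4 ^ k <= N k).
  { intros k. unfold N. specialize (Hp k). destruct (p k) as [[? ?] ?]. apply Hp. }
  assert (HL : forall k y, norm (L (i k) y) <= N k * norm y).
  { intros k. unfold N, i. specialize (Hp k). destruct (p k) as [[? ?] ?]. apply Hp. }
  assert (Hw : forall k, norm (w k) <= (/ 3) ^ k).
  { intros k. unfold w. specialize (Hp k). destruct (p k) as [[? ?] ?]. apply Hp. }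
  assert (Hbig : forall k, 3 / 4 * ((/ 3) ^ k * N k) <= norm (L (i k) (w k))).
  { intros k. unfold N, i, w. specialize (Hp k). destruct (p k) as [[? ?] ?]. apply Hp. }
  clearbody i w N. clear p Hp.
  (* One of the two signs does not decrease the norm of the image, since
     2 L w = L (x + w) - L (x - w). *)
  assert (Hstep : forall (k : nat) (x : X), exists x' : X, norm (minus x' x) <= (/ 3) ^ k /\
    norm (L (i k) (w k)) <= norm (L (i k) x')).
  { intros k x.
    destruct (Rle_dec (norm (L (i k) (w k))) (norm (L (i k) (plus x (w k))))) as [H|H].
    - exists (plus x (w k)). split; [|assumption].
      replace (minus (plus x (w k)) x) with (w k) by vector. apply Hw.
    - exists (minus x (w k)). split.
      + replace (minus (minus x (w k)) x) with (opp (w k)) by vector.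
        rewrite norm_neg. apply Hw.
      + pose proof (norm_minus_le (L (i k) (plus x (w k))) (L (i k) (minus x (w k)))) as Ht.
        rewrite <- lin_minus in Ht by apply Llin.
        replace (minus (plus x (w k)) (minus x (w k))) with (2 *: w k) in Ht by vector.
        rewrite (lin_rscal _ (Llin _)), norm_rscal_pos in Ht by lra. lra. }
  destruct (functional_choice (fun (kx : nat * X) (x' : X) => norm (minus x' (snd kx)) <= (/ 3) ^ (fst kx) /\
    norm (L (i (fst kx)) (w (fst kx))) <= norm (L (i (fst kx)) x'))
    (fun kx => Hstep (fst kx) (snd kx))) as [step Hst].
  set (x := fix x (n : nat) : X := match n with O => zero | S n => step (n, x n) end).
  assert (Hdiff : forall k j,
    norm (minus (x (k + j)%nat) (x k)) <= 3 / 2 * ((/ 3) ^ k - (/ 3) ^ (k + j))).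
  { intros k j. induction j as [|j IH].
    - rewrite Nat.add_0_r. replace (minus (x k) (x k)) with (zero : X) by vector.
      rewrite norm_null. lra.
    - rewrite Nat.add_succ_r.
      pose proof (norm_minus_trans (x (k + j)%nat) (x (S (k + j))) (x k)) as Ht.
      pose proof (proj1 (Hst ((k + j)%nat, x (k + j)%nat))) as Hs.
      change (step (_, _)) with (x (S (k + j))) in Hs. cbn [fst snd] in Hs.
      cbn [pow]. lra. }
  assert (Hle : forall k n, (k <= n)%nat -> norm (minus (x n) (x k)) <= 3 / 2 * (/ 3) ^ k).
  { intros k n Hkn. replace n with (k + (n - k))%nat by lia.
    eapply Rle_trans; [apply Hdiff|].
    pose proof (pow_lt (/ 3) (k + (n - k)) ltac:(lra)). lra. }
  destruct (cauchy_sequence_limit x) as [y Hy].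
  { intros e He. destruct (pow_lt_1_zero (/ 3)) with (y := e / 3) as [k Hk].
    - rewrite Rabs_pos_eq; lra.
    - lra.
    - exists k. intros m n Hm Hn. specialize (Hk k (Nat.le_refl k)).
      rewrite Rabs_pos_eq in Hk by (apply pow_le; lra).
      pose proof (norm_minus_trans (x k) (x n) (x m)) as Ht.
      rewrite (norm_minus_sym (x k) (x m)) in Ht.
      pose proof (Hle k n Hn). pose proof (Hle k m Hm). lra. }
  destruct (Lpt y) as [C HC].
  destruct (Pow_x_infinity (4 / 3)) with (b := 4 * C + 1) as [k Hk].
  { rewrite Rabs_pos_eq; lra. }
  specialize (Hk k (Nat.le_refl k)).
  rewrite Rabs_pos_eq in Hk by (apply pow_le; lra).
  assert (Hyk : norm (minus y (x (S k))) <= 1 / 2 * (/ 3) ^ k).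
  { apply (norm_limit_le x _ _ _ (S k) Hy). intros n Hn.
    eapply Rle_trans; [apply Hle, Hn|]. cbn [pow]. lra. }
  pose proof (proj2 (Hst (k, x k))) as Hs.
  change (step (_, _)) with (x (S k)) in Hs. cbn [fst snd] in Hs.
  specialize (HC (i k)). specialize (Hbig k).
  pose proof (HL k (minus y (x (S k)))) as Hr.
  rewrite lin_minus in Hr by apply Llin.
  pose proof (norm_triangle_inv (V := X) (L (i k) (x (S k))) (L (i k) y)) as Hi.
  change (norm (minus (L (i k) (x (S k))) (L (i k) y)))
    with (norm (minus (L (i k) (x (S k))) (L (i k) y) : X)) in Hi.
  rewrite (norm_minus_sym (L _ (x _))) in Hi.
  pose proof (Rle_abs (norm (L (i k) (x (S k))) - norm (L (i k) y))) as Ha.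
  assert (Hpow : (4 / 3) ^ k <= (/ 3) ^ k * N k).
  { unfold Rdiv. rewrite Rpow_mult_distr, Rmult_comm.
    apply Rmult_le_compat_l; [apply pow_le; lra|apply HN]. }
  assert (N k * norm (minus y (x (S k))) <= N k * (1 / 2 * (/ 3) ^ k)).
  { apply Rmult_le_compat_l; [|assumption].
    apply Rle_trans with (4 ^ k); [apply pow_le; lra|apply HN]. }
  lra.
Qed.

(** * Semigroups and their generators *)

Lemma at_right_0 (P : R -> Prop) :
  at_right 0 P <-> exists d, 0 < d /\ forall h, 0 < h < d -> P h.
Proof.
  split.
  - intros [d Hd]. exists d. split; [apply cond_pos|]. intros h Hh. apply Hd; [|lra].
    change (Rabs (h - 0) < d). rewrite Rminus_0_r, Rabs_pos_eq; lra.
  - intros [d [Hd HP]]. exists (mkposreal d Hd). intros h Hb Hh. apply HP. split; [lra|].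
    change (Rabs (h - 0) < d) in Hb. rewrite Rminus_0_r, Rabs_pos_eq in Hb; lra.
Qed.

Lemma limit_at_right_0 {X : Banach} (f : R -> X) (y : X) :
  filterlim f (at_right 0) (locally y) <->
  forall e, 0 < e -> exists d, 0 < d /\ forall h, 0 < h < d -> norm (minus (f h) y) < e.
Proof.
  rewrite norm_limit. split; intros H e He; apply at_right_0; now apply H.
Qed.

Lemma le_of_le_plus_eps (a b C : R) : 0 <= C ->
  (forall e, 0 < e -> a <= b + C * e) -> a <= b.
Proof.
  intros HC H. apply le_epsilon. intros e He.
  assert (Hq : 0 < e / (C + 1)) by (apply Rdiv_lt_0_compat; lra).
  specialize (H _ Hq).
  assert (C * (e / (C + 1)) <= e); [|lra].
  replace e with ((C + 1) * (e / (C + 1))) at 2 by (field; lra). nra.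
Qed.

Lemma small_step (d : R) : 0 < d -> exists n : nat, forall k, (n <= k)%nat -> / INR (S k) < d.
Proof.
  intros Hd. destruct (archimed_cor1 d Hd) as [N [HN HN0]]. exists N. intros k Hk.
  apply Rle_lt_trans with (/ INR N); [|assumption].
  apply Rinv_le_contravar; [now apply lt_0_INR|apply le_INR; lia].
Qed.

Definition bounded_on {X : Banach} (T : R -> X -> X) (H M : R) : Prop :=
  forall t x, 0 <= t <= H -> norm (T t x) <= M * norm x.

(** Otherwise some sequence of times tending to 0 has unbounded operator norms,
    although each orbit converges along it. *)
Lemma semigroup_bounded_near_0 {X : Banach} (T : R -> X -> X) : is_C0_semigroup T ->
  exists d M, 0 < d /\ bounded_on T d M.
Proof.
  intros [Tlin [T0 [_ Tcont]]]. apply NNPP. intros Hno.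
  assert (Ht : forall n : nat, exists t, 0 < t <= / INR (S n) /\
    exists x : X, INR n * norm x < norm (T t x)).
  { intros n. apply NNPP. intros Hall. apply Hno.
    exists (/ INR (S n)), (INR (S n)). split; [apply Rinv_0_lt_compat, lt_0_INR; lia|].
    pose proof (pos_INR n) as Hn0.
    intros t x Ht. pose proof (norm_ge_0 x) as Hx. destruct (Req_dec t 0) as [->|Ht0].
    - rewrite T0, S_INR. nra.
    - apply Rle_trans with (INR n * norm x); [|rewrite S_INR; lra].
      apply Rnot_lt_le. intros Hlt. apply Hall. exists t. split; [lra|now exists x]. }
  destruct (functional_choice _ Ht) as [t Hts]. clear Ht Hno.
  destruct (uniform_boundedness (fun n => T (t n))) as [C HC].
  - intros n. apply Tlin. specialize (Hts n). lra.
  - intros x. destruct (filterlim_bounded (V := X) (fun n => T (t n) x)) as [C HC].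
    + exists x. apply norm_limit. intros e He.
      destruct (proj1 (limit_at_right_0 _ _) (Tcont x) e He) as [d [Hd Hlim]].
      destruct (small_step d Hd) as [N HN]. exists N. intros n Hn. apply Hlim.
      specialize (HN n Hn). destruct (Hts n) as [Htn _]. lra.
    + now exists C.
  - destruct (INR_unbounded C) as [n Hn]. destruct (Hts n) as [_ [x Hx]].
    specialize (HC n x). cbv beta in HC. pose proof (norm_ge_0 x). nra.
Qed.

Lemma semigroup_bounded {X : Banach} (T : R -> X -> X) (H : R) : is_C0_semigroup T ->
  exists M, 1 <= M /\ bounded_on T H M.
Proof.
  intros HT. destruct (semigroup_bounded_near_0 T HT) as [d [M0 [Hd HM0]]].
  destruct HT as [_ [_ [Tadd _]]].
  (* With M >= 1 the bounds M^k increase, which covers all smaller times. *)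
  set (M := Rmax 1 M0). pose proof (Rmax_l 1 M0 : 1 <= M) as HM.
  assert (Hb : forall n : nat, bounded_on T (INR n * d) (M ^ S n)).
  { intros n. induction n as [|n IH]; intros t x Ht.
    - rewrite pow_1. apply Rle_trans with (M0 * norm x).
      + apply HM0. cbn in Ht. lra.
      + apply Rmult_le_compat_r; [apply norm_ge_0|apply Rmax_r].
    - rewrite S_INR in Ht. pose proof (norm_ge_0 x) as Hx.
      pose proof (pow_R1_Rle M (S n) HM) as Hp.
      destruct (Rle_dec t (INR n * d)) as [Hle|Hgt].
      + apply Rle_trans with (M ^ S n * norm x); [apply IH; lra|].
        apply Rmult_le_compat_r; [assumption|].
        change (M ^ S (S n)) with (M * M ^ S n). nra.
      + replace t with (d + (t - d)) by ring.
        destruct (Rle_dec d t) as [Hdt|Hdt].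
        * rewrite Tadd by lra.
          apply Rle_trans with (M * norm (T (t - d) x)).
          -- apply Rle_trans with (M0 * norm (T (t - d) x)); [apply HM0; lra|].
             apply Rmult_le_compat_r; [apply norm_ge_0|apply Rmax_r].
          -- change (M ^ S (S n)) with (M * M ^ S n). rewrite Rmult_assoc.
             apply Rmult_le_compat_l; [lra|]. apply IH. lra.
        * replace (d + (t - d)) with t by ring.
          apply Rle_trans with (M0 * norm x); [apply HM0; lra|].
          apply Rmult_le_compat_r; [assumption|].
          apply Rle_trans with M; [apply Rmax_r|].
          change (M ^ S (S n)) with (M * M ^ S n). nra. }
  destruct (INR_unbounded (H / d)) as [n Hn].
  exists (M ^ S n). split; [now apply pow_R1_Rle|].
  intros t x Ht. apply Hb. split; [lra|].
  apply Rle_trans with (H / d * d); [|apply Rmult_le_compat_r; lra].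
  replace (H / d * d) with H by (field; lra). lra.
Qed.

Lemma bounded_on_le {X : Banach} (T : R -> X -> X) (H H' M : R) :
  bounded_on T H M -> H' <= H -> bounded_on T H' M.
Proof. intros Mb Hle t x Ht. apply Mb. lra. Qed.

Lemma common_bound {X : Banach} (S T : R -> X -> X) (H : R) :
  is_C0_semigroup S -> is_C0_semigroup T ->
  exists M, 1 <= M /\ bounded_on S H M /\ bounded_on T H M.
Proof.
  intros HS HT. destruct (semigroup_bounded S H HS) as [M [HM Mb]].
  destruct (semigroup_bounded T H HT) as [N [HN Nb]].
  exists (Rmax M N). split; [|split].
  - eapply Rle_trans; [exact HM|apply Rmax_l].
  - intros t x Ht. eapply Rle_trans; [apply Mb, Ht|].
    apply Rmult_le_compat_r; [apply (norm_ge_0 (V := X))|apply Rmax_l].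
  - intros t x Ht. eapply Rle_trans; [apply Nb, Ht|].
    apply Rmult_le_compat_r; [apply (norm_ge_0 (V := X))|apply Rmax_r].
Qed.

(** The definition of the generator without division by [h], which is the form
    that telescoping sums use. *)
Lemma generator_difference {X : Banach} (G : operator X) (S : R -> X -> X) (y z : X) :
  is_generator G S ->
  dom G y /\ ap G y = z <->
  forall e, 0 < e -> exists d, 0 < d /\ forall h, 0 < h < d ->
    norm (minus (minus (S h y) y) (h *: z)) <= e * h.
Proof.
  intros [_ HG]. eapply iff_trans; [apply HG|].
  eapply iff_trans; [exact (limit_at_right_0 (fun h => / h *: minus (S h y) y) z)|].
  assert (E : forall h, 0 < h -> norm (minus (/ h *: minus (S h y) y) z) * h =
    norm (minus (minus (S h y) y) (h *: z))).
  { intros h Hh. rewrite Rmult_comm, <- norm_rscal_pos by lra. f_equal.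
    vector; lra. }
  split; intros H e He.
  - destruct (H e He) as [d [Hd Hlim]]. exists d. split; [assumption|].
    intros h Hh. rewrite <- E by lra.
    apply Rmult_le_compat_r; [lra|]. apply Rlt_le. now apply Hlim.
  - destruct (H (e / 2)) as [d [Hd Hlim]]; [lra|]. exists d. split; [assumption|].
    intros h Hh. specialize (Hlim h Hh). rewrite <- E in Hlim by lra.
    apply Rmult_le_reg_r in Hlim; [|lra].
    apply Rle_lt_trans with (e / 2); [exact Hlim|lra].
Qed.

(** Common source of the invariance of D(G) under the semigroup and of the
    homogeneity of G. *)
Lemma generator_commutes {X : Banach} (G : operator X) (S : R -> X -> X) (L : X -> X) (y : X) :
  is_generator G S -> is_linear L -> (forall h x, 0 < h -> S h (L x) = L (S h x)) ->
  dom G y -> dom G (L y) /\ ap G (L y) = L (ap G y).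
Proof.
  intros HG HL Hcomm Hy. destruct (linear_bound L HL) as [M [HM Mb]].
  apply (generator_difference G S (L y) (L (ap G y)) HG). intros e He.
  destruct (proj1 (generator_difference G S y (ap G y) HG) (conj Hy eq_refl) (e / M))
    as [d [Hd Hlim]]; [now apply Rdiv_lt_0_compat|].
  exists d. split; [assumption|]. intros h Hh. rewrite Hcomm by lra.
  rewrite <- (lin_rscal L HL), <- !(lin_minus L HL).
  eapply Rle_trans; [apply Mb|].
  replace (e * h) with (M * (e / M * h)) by (field; lra).
  apply Rmult_le_compat_l; [lra|]. now apply Hlim.
Qed.

Lemma generator_semigroup {X : Banach} (G : operator X) (S : R -> X -> X) (t : R) (y : X) :
  is_generator G S -> 0 <= t -> dom G y ->
  dom G (S t y) /\ ap G (S t y) = S t (ap G y).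
Proof.
  intros HG Ht Hy. pose proof HG as [[Slin [_ [Sadd _]]] _].
  apply (generator_commutes G S (S t) y HG); [now apply Slin| |assumption].
  intros h x Hh. rewrite <- !Sadd by lra. f_equal. ring.
Qed.

Lemma generator_scal {X : Banach} (G : operator X) (S : R -> X -> X) (k : C_AbsRing) (y : X) :
  is_generator G S -> dom G y -> dom G (scal k y) /\ ap G (scal k y) = scal k (ap G y).
Proof.
  intros HG. pose proof HG as [[Slin _] _].
  apply (generator_commutes G S (fun x => scal k x) y HG).
  - apply (is_linear_scal_r (V := X)). intros m n. apply Cmult_comm.
  - intros h x Hh. apply lin_scal. apply Slin. lra.
Qed.

(** Stands in for S(H) y - y - H G y = integral of (S(r) - 1) G y over (0, H).
    The left side is cut into n steps of length h = H / n, each contributing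
    S(kh) (S(h) y - y - h G y), which is o(h), and h (S(kh) - 1) G y. *)
Lemma generator_remainder {X : Banach} (G : operator X) (S : R -> X -> X) (H M w : R) (y : X) :
  is_generator G S -> 0 <= M -> bounded_on S H M -> dom G y -> 0 <= H ->
  (forall r, 0 <= r <= H -> norm (minus (S r (ap G y)) (ap G y)) <= w) ->
  norm (minus (minus (S H y) y) (H *: ap G y)) <= H * w.
Proof.
  intros HG HM Mb Hy HH Hw. pose proof HG as [[Slin [S0 [Sadd _]]] _].
  apply (le_of_le_plus_eps _ _ (H * M)); [nra|]. intros e He.
  destruct (proj1 (generator_difference G S y (ap G y) HG) (conj Hy eq_refl) e He)
    as [d [Hd Hlim]].
  destruct (INR_unbounded (H / d)) as [n0 Hn0].
  set (n := Datatypes.S n0). assert (Hn : 0 < INR n) by (apply lt_0_INR; lia).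
  destruct (Req_dec H 0) as [->|HH0].
  { rewrite S0. replace (minus (minus y y) (0 *: ap G y)) with (zero : X) by vector.
    rewrite norm_null. lra. }
  set (h := H / INR n).
  assert (Hh : 0 < h < d).
  { split; [apply Rdiv_lt_0_compat; lra|]. unfold h.
    apply Rmult_lt_reg_r with (INR n); [assumption|].
    replace (H / INR n * INR n) with (H / d * d) by (field; lra).
    rewrite Rmult_comm. apply Rmult_lt_compat_l; [assumption|].
    unfold n. rewrite S_INR. lra. }
  assert (Hnh : INR n * h = H) by (unfold h; field; lra).
  assert (Hk : forall k, (k <= n)%nat ->
    norm (minus (minus (S (INR k * h) y) y) ((INR k * h) *: ap G y)) <=
    INR k * (h * (M * e + w))).
  { intros k. induction k as [|k IH]; intros Hkn.
    - cbn [INR]. rewrite !Rmult_0_l, S0.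
      replace (minus (minus y y) (0 *: ap G y)) with (zero : X) by vector.
      rewrite norm_null. lra.
    - specialize (IH ltac:(lia)). set (s := INR k * h).
      fold s in IH. pose proof (pos_INR k) as Hk0.
      assert (Hs : 0 <= s <= H).
      { split; [unfold s; nra|]. rewrite <- Hnh. unfold s.
        apply Rmult_le_compat_r; [lra|]. apply le_INR. lia. }
      rewrite !S_INR. replace ((INR k + 1) * h) with (s + h) by (unfold s; ring).
      rewrite Sadd by lra.
      pose proof (Mb s (minus (minus (S h y) y) (h *: ap G y)) Hs) as Hrem.
      rewrite !(lin_minus _ (Slin s (proj1 Hs))), (lin_rscal _ (Slin s (proj1 Hs))) in Hrem.
      pose proof (norm_rscal_pos h (minus (S s (ap G y)) (ap G y)) ltac:(lra)) as Hdef.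
      replace (minus (minus (S s (S h y)) y) ((s + h) *: ap G y)) with
        (plus (minus (minus (S s y) y) (s *: ap G y))
           (plus (minus (minus (S s (S h y)) (S s y)) (h *: S s (ap G y)))
              (h *: minus (S s (ap G y)) (ap G y)))) by vector.
      eapply Rle_trans; [apply (norm_triangle (V := X))|].
      eapply Rle_trans; [apply Rplus_le_compat_l, (norm_triangle (V := X))|].
      rewrite Hdef. specialize (Hw s Hs). specialize (Hlim h Hh).
      assert (M * norm (minus (minus (S h y) y) (h *: ap G y)) <= M * (e * h))
        by (apply Rmult_le_compat_l; assumption).
      assert (h * norm (minus (S s (ap G y)) (ap G y)) <= h * w)
        by (apply Rmult_le_compat_l; lra).
      lra. }
  specialize (Hk n (Nat.le_refl n)). rewrite Hnh in Hk.
  eapply Rle_trans; [exact Hk|]. rewrite <- Rmult_assoc, Hnh. lra.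
Qed.

(** The previous estimate with the crude bound (M + 1) |G y| for its remainder. *)
Lemma generator_lipschitz {X : Banach} (G : operator X) (S : R -> X -> X) (h M : R) (y : X) :
  is_generator G S -> 0 <= M -> bounded_on S h M -> dom G y -> 0 <= h ->
  norm (minus (S h y) y) <= h * ((M + 2) * norm (ap G y)).
Proof.
  intros HG HM Mb Hy Hh.
  pose proof (generator_remainder G S h M ((M + 1) * norm (ap G y)) y HG HM Mb Hy Hh) as Hrem.
  replace (minus (S h y) y) with
    (plus (minus (minus (S h y) y) (h *: ap G y)) (h *: ap G y)) by vector.
  eapply Rle_trans; [apply (norm_triangle (V := X))|].
  rewrite norm_rscal_pos by assumption.
  assert (Hw : forall r, 0 <= r <= h ->
    norm (minus (S r (ap G y)) (ap G y)) <= (M + 1) * norm (ap G y)).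
  { intros r Hr. eapply Rle_trans; [apply norm_minus_le|].
    specialize (Mb r (ap G y) Hr). lra. }
  specialize (Hrem Hw). lra.
Qed.

(** * Compact operators and the distance to them *)

Lemma compact_zero {X : Banach} : compact_operator (fun _ : X => zero : X).
Proof.
  split; [apply (is_linear_zero (U := X) (V := X))|].
  intros u _. exists (fun n => n). split; [intros; lia|].
  exists zero. apply filterlim_const.
Qed.

Lemma compact_comp {X : Banach} (L K N : X -> X) :
  is_linear L -> compact_operator K -> is_linear N ->
  compact_operator (fun x => L (K (N x))).
Proof.
  intros HL [Klin Kc] HN. split.
  - apply (is_linear_comp (fun x => K (N x)) L); [|assumption].
    now apply (is_linear_comp N K).
  - intros u [C HC]. destruct (linear_bound N HN) as [M [HM Mb]].
    destruct (Kc (fun n => N (u n))) as [phi [Hphi [y Hy]]].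
    { exists (M * C). intros n. eapply Rle_trans; [apply Mb|].
      apply Rmult_le_compat_l; [lra|apply HC]. }
    exists phi. split; [assumption|]. exists (L y).
    exact (filterlim_comp _ _ _ _ L _ _ _ Hy (linear_cont L y HL)).
Qed.

Lemma extraction_ge (phi : nat -> nat) :
  (forall n, (phi n < phi (S n))%nat) -> forall n, (n <= phi n)%nat.
Proof. intros H n. induction n as [|n IH]; [lia|]. specialize (H n). lia. Qed.

Lemma compact_plus {X : Banach} (K L : X -> X) :
  compact_operator K -> compact_operator L ->
  compact_operator (fun x => plus (K x) (L x)).
Proof.
  intros [Klin Kc] [Llin Lc]. split.
  - split.
    + intros x y. rewrite (lin_plus K Klin), (lin_plus L Llin). vector.
    + intros k x. rewrite (lin_scal K Klin), (lin_scal L Llin).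
      symmetry. exact (scal_distr_l (V := X) k _ _).
    + destruct (linear_bound K Klin) as [M [HM Mb]].
      destruct (linear_bound L Llin) as [N [HN Nb]].
      exists (M + N). split; [lra|]. intros x.
      eapply Rle_trans; [apply (norm_triangle (V := X))|].
      specialize (Mb x). specialize (Nb x).
      apply Rle_trans with (M * norm x + N * norm x); [now apply Rplus_le_compat|lra].
  - intros u [C HC]. destruct (Kc u) as [phi [Hphi [y Hy]]]; [now exists C|].
    destruct (Lc (fun n => u (phi n))) as [psi [Hpsi [z Hz]]]; [now exists C|].
    assert (Hmono : forall m n, (m < n)%nat -> (phi m < phi n)%nat).
    { intros m n Hmn. induction Hmn as [|n Hmn IH]; [apply Hphi|].
      specialize (Hphi n). lia. }
    exists (fun n => phi (psi n)). split; [intros n; apply Hmono, Hpsi|].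
    exists (plus y z).
    assert (Hy' : filterlim (fun n => K (u (phi (psi n)))) eventually (locally y)).
    { apply norm_limit. intros e He.
      destruct (proj1 (norm_limit _ y) Hy e He) as [N HN].
      exists N. intros n Hn. apply HN. pose proof (extraction_ge psi Hpsi n). lia. }
    exact (filterlim_comp_2 _ _ _ Hy' Hz (filterlim_plus (V := X) y z)).
Qed.

Lemma opnorm_le {X : Banach} (L : X -> X) (r : R) :
  Rbar_le (opnorm L) (Finite r) -> forall x, norm x <= 1 -> norm (L x) <= r.
Proof.
  intros H x Hx.
  apply (Rbar_le_trans (Finite (norm (L x))) (opnorm L) (Finite r)); [|assumption].
  apply (proj1 (Lub_Rbar_correct _)). now exists x.
Qed.

Lemma opnorm_bounded {X : Banach} (L : X -> X) (r : R) :
  (forall x, norm (L x) <= r * norm x) -> 0 <= r ->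
  exists r', opnorm L = Finite r' /\ r' <= r.
Proof.
  intros Lb Hr.
  assert (Hnull : (fun r => exists x : X, norm x <= 1 /\ r = norm (L x)) (norm (L zero))).
  { exists zero. split; [|reflexivity]. rewrite norm_null. lra. }
  destruct (Lub_Rbar_correct (fun r => exists x : X, norm x <= 1 /\ r = norm (L x)))
    as [Hub Hlub]. fold (opnorm L) in Hub, Hlub.
  assert (Hle : Rbar_le (opnorm L) (Finite r)).
  { apply Hlub. intros q [x [Hx ->]]. cbn. eapply Rle_trans; [apply Lb|].
    rewrite <- (Rmult_1_r r) at 2. now apply Rmult_le_compat_l. }
  specialize (Hub _ Hnull).
  destruct (opnorm L) as [r'| |]; [now exists r'|contradiction|contradiction].
Qed.

Lemma opnorm_ge_0 {X : Banach} (L : X -> X) (r : R) : opnorm L = Finite r -> 0 <= r.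
Proof.
  intros HL. apply Rle_trans with (norm (L zero)); [apply norm_ge_0|].
  apply (opnorm_le L r); [rewrite HL; apply Rle_refl|]. rewrite norm_null. lra.
Qed.

(** For a bounded [L] the infimum is taken over a nonempty set of nonnegative
    numbers, hence finite, and it can be approached. *)
Lemma dist_to_compact_lt {X : Banach} (L : X -> X) (e : R) :
  is_linear L -> dist_to_compact L < e ->
  exists (K : X -> X) (r : R), compact_operator K /\ r < e /\
    forall x, norm (minus (L x) (K x)) <= r * norm x.
Proof.
  intros HL Hlt. unfold dist_to_compact in Hlt.
  set (E := fun r => exists K : X -> X, compact_operator K /\
    opnorm (fun x => minus (L x) (K x)) = Finite r) in *.
  destruct (Glb_Rbar_correct E) as [Hlb Hglb].
  assert (Hex : exists r, E r).
  { destruct (linear_bound L HL) as [M [HM Mb]].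
    destruct (opnorm_bounded (fun x => minus (L x) (zero : X)) M) as [r [Hr _]]; [|lra|].
    - intros x. replace (minus (L x) (zero : X)) with (L x) by vector. apply Mb.
    - exists r, (fun _ : X => zero : X). split; [apply compact_zero|exact Hr]. }
  assert (Hfin : exists g, Glb_Rbar E = Finite g).
  { destruct Hex as [r Hr]. specialize (Hlb r Hr).
    assert (H0 : is_lb_Rbar E (Finite 0)).
    { intros q [K [_ HK]]. apply (opnorm_ge_0 _ _ HK). }
    specialize (Hglb _ H0). destruct (Glb_Rbar E) as [g| |]; [now exists g|contradiction|contradiction]. }
  destruct Hfin as [g Hg]. rewrite Hg in *. cbn in Hlt.
  assert (Hr : exists r, E r /\ r < e).
  { apply NNPP. intros Hno. apply (Rlt_irrefl g). apply Rlt_le_trans with e; [assumption|].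
    apply (Hglb (Finite e)). intros q Hq. apply Rnot_lt_le. intros Hqe. apply Hno. now exists q. }
  destruct Hr as [r [[K [Kcomp HK]] Hre]]. exists K, r.
  split; [assumption|]. split; [assumption|].
  apply (bound_of_unit_ball (fun x => minus (L x) (K x))).
  - intros k x. rewrite (lin_scal L HL), (lin_scal K (proj1 Kcomp)).
    symmetry. exact (scal_minus_distr_l (V := X) k _ _).
  - apply (opnorm_le (fun x => minus (L x) (K x))). rewrite HK. apply Rle_refl.
Qed.

Lemma dist_to_compact_bounds {X : Banach} (L K : X -> X) (r : R) :
  compact_operator K -> 0 <= r -> (forall x, norm (minus (L x) (K x)) <= r * norm x) ->
  0 <= dist_to_compact L <= r.
Proof.
  intros Kcomp Hr HLK. unfold dist_to_compact.
  destruct (opnorm_bounded _ r HLK Hr) as [q [Hq Hqr]].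
  set (E := fun r => exists K : X -> X, compact_operator K /\
    opnorm (fun x => minus (L x) (K x)) = Finite r) in *.
  destruct (Glb_Rbar_correct E) as [Hlb Hglb].
  assert (H0 : is_lb_Rbar E (Finite 0)).
  { intros p [K' [_ HK]]. apply (opnorm_ge_0 _ _ HK). }
  specialize (Hglb _ H0). specialize (Hlb q (ex_intro _ K (conj Kcomp Hq))).
  destruct (Glb_Rbar E) as [g| |]; [|contradiction|contradiction].
  cbn in *. lra.
Qed.

(** Strong convergence at time 0 is uniform on the relatively compact image of
    the unit ball under [K]: otherwise violating vectors have a subsequence whose
    images converge to some y, and convergence of the orbit of y, together with
    the local bound, gives a contradiction. *)
Lemma semigroup_uniform_on_compact {X : Banach} (S : R -> X -> X) (K : X -> X) (e : R) :
  is_C0_semigroup S -> compact_operator K -> 0 < e ->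
  exists d, 0 < d /\ forall h x, 0 <= h < d ->
    norm (minus (S h (K x)) (K x)) <= e * norm x.
Proof.
  intros HS [Klin Kcomp] He. destruct (semigroup_bounded S 1 HS) as [M [HM Mb]].
  destruct HS as [Slin [S0 [_ Scont]]].
  apply NNPP. intros Hno.
  assert (Hk : forall n : nat, exists p : R * X, 0 < fst p <= / INR (Datatypes.S n) /\
    norm (snd p) <= 1 /\ e < norm (minus (S (fst p) (K (snd p))) (K (snd p)))).
  { intros n. apply NNPP. intros Hall. apply Hno. exists (/ INR (Datatypes.S n)).
    split; [apply Rinv_0_lt_compat, lt_0_INR; lia|].
    intros h x Hh. destruct (Req_dec h 0) as [->|Hh0].
    { rewrite S0. replace (minus (K x) (K x)) with (zero : X) by vector.
      rewrite norm_null. apply Rmult_le_pos; [lra|apply (norm_ge_0 (V := X))]. }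
    apply (bound_of_unit_ball (fun x => minus (S h (K x)) (K x))).
    - intros k z. rewrite (lin_scal K Klin), (lin_scal (S h)) by (apply Slin; lra).
      symmetry. exact (scal_minus_distr_l (V := X) k _ _).
    - intros z Hz. apply Rnot_lt_le. intros Hlt. apply Hall.
      exists (h, z). cbn [fst snd]. repeat split; lra. }
  destruct (functional_choice _ Hk) as [p Hp]. clear Hk Hno.
  destruct (Kcomp (fun n => snd (p n))) as [phi [Hphi [y Hy]]].
  { exists 1. intros n. apply Hp. }
  assert (Hq : 0 < e / (2 * (M + 1))) by (apply Rdiv_lt_0_compat; lra).
  destruct (proj1 (norm_limit _ y) Hy _ Hq) as [N HN].
  destruct (proj1 (limit_at_right_0 _ _) (Scont y) (e / 2)) as [d [Hd Hlim]]; [lra|].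
  destruct (small_step d Hd) as [N' HN'].
  set (m := phi (N + N')%nat). pose proof (extraction_ge phi Hphi (N + N')) as Hm. fold m in Hm.
  specialize (HN (N + N')%nat ltac:(lia)). fold m in HN. specialize (HN' m ltac:(lia)).
  destruct (Hp m) as [Hh [_ Hbig]].
  set (h := fst (p m)) in *. set (k := K (snd (p m))) in *.
  assert (Hh1 : h <= 1).
  { apply Rle_trans with (/ INR (Datatypes.S m)); [apply Hh|].
    rewrite <- Rinv_1. apply Rinv_le_contravar; [lra|].
    rewrite S_INR. pose proof (pos_INR m). lra. }
  specialize (Hlim h ltac:(lra)).
  pose proof (Mb h (minus k y) ltac:(lra)) as Hb.
  rewrite (lin_minus (S h)) in Hb by (apply Slin; lra).
  pose proof (norm_minus_trans (S h y) (S h k) k) as H1.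
  pose proof (norm_minus_trans y (S h y) k) as H2.
  rewrite (norm_minus_sym y k) in H2.
  assert (E : e / (2 * (M + 1)) * (M + 1) = e / 2) by (field; lra).
  assert (HN1 : norm (minus k y) <= e / (2 * (M + 1))) by (apply Rlt_le; exact HN).
  assert (Hlim1 : norm (minus (S h y) y) < e / 2) by exact Hlim.
  pose proof (Rmult_le_compat_l M _ _ ltac:(lra) HN1). lra.
Qed.

(** * Bounds for A T(s) and B T(s) at small times *)

(** The right half of the two-sided derivative at [t] is the derivative at 0 of
    the orbit of [T t x]. *)
Lemma generator_immediate {X : Banach} (A : operator X) (T : R -> X -> X) :
  is_generator A T -> immediately_differentiable T ->
  forall t x, 0 < t -> dom A (T t x).
Proof.
  intros genA diffT t x Ht. pose proof genA as [[_ [_ [Tadd _]]] HG].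
  destruct (diffT x t Ht) as [y Hy].
  apply (proj2 (HG (T t x) y)). apply limit_at_right_0. intros e He.
  pose proof (proj1 (norm_limit _ y) Hy e He) as [d Hd].
  exists d. split; [apply cond_pos|]. intros h Hh.
  assert (Hlim : norm (minus (/ h *: minus (T (t + h) x) (T t x)) y) < e).
  { apply Hd; [|lra]. change (Rabs (h - 0) < d).
    rewrite Rminus_0_r, Rabs_pos_eq; lra. }
  rewrite (Rplus_comm t), Tadd in Hlim by lra. exact Hlim.
Qed.

Lemma composite_scal {X : Banach} (A : operator X) (T : R -> X -> X) (s : R) :
  is_generator A T -> 0 < s -> (forall x, dom A (T s x)) ->
  forall k x, ap A (T s (scal k x)) = scal k (ap A (T s x)).
Proof.
  intros genA Hs Hdom k x. pose proof genA as [[Tlin _] _].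
  rewrite (lin_scal _ (Tlin s ltac:(lra))).
  now apply (generator_scal A T k (T s x) genA).
Qed.

(** Bounding by [Rpower] at a positive [v] removes the case distinction at 0. *)
Lemma rpow_le (u v p : R) : 0 < p -> 0 < v -> u <= v -> rpow u p <= Rpower v p.
Proof.
  intros Hp Hv Huv. unfold rpow. destruct (Rlt_dec 0 u) as [Hu|Hu].
  - apply Rle_Rpower_l; lra.
  - destruct (Req_EM_T p 0) as [H0|_]; [lra|]. apply Rlt_le, exp_pos.
Qed.

Lemma rpow_ge_0 (u p : R) : 0 <= rpow u p.
Proof.
  unfold rpow. destruct (Rlt_dec 0 u); [apply Rlt_le, exp_pos|].
  destruct (Req_EM_T p 0); lra.
Qed.

(** The exponent comes from (s^(-1/alpha))^theta = s^(-theta/alpha), which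
    subordination produces on the unit ball. *)
Lemma crandall_pazy_bounds {X : Banach} (A B : operator X) (T : R -> X -> X)
  (alpha theta : R) :
  is_generator A T -> crandall_pazy A T alpha -> subordinate B A theta -> 0 < theta ->
  (forall t, 0 < t -> compact_operator (fun x => ap B (T t x))) ->
  exists d C, 0 < d /\ 0 < C /\ forall s, 0 < s < d ->
    (exists a, 0 <= a /\ forall x, norm (ap A (T s x)) <= a * norm x) /\
    forall x, norm (ap B (T s x)) <= C * Rpower s (- (theta / alpha)) * norm x.
Proof.
  intros genA [Halpha [diffT [M HM]]] [Htheta [_ [c [Hc Hsub]]]] Htheta0 compBT.
  pose proof (generator_immediate A T genA diffT) as Hdom.
  apply at_right_0 in HM. destruct HM as [d [Hd HM]].
  destruct (semigroup_bounded T d (proj1 genA)) as [N [HN Nb]].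
  set (M1 := Rmax 1 M). pose proof (Rmax_l 1 M : 1 <= M1) as HM1.
  pose proof (Rmax_r 1 M : M <= M1) as HM1'.
  exists d, (c * Rpower M1 theta * Rpower N (1 - theta)).
  split; [assumption|]. split.
  { repeat apply Rmult_lt_0_compat; [assumption|apply exp_pos|apply exp_pos]. }
  intros s Hs. set (a := M1 * Rpower s (- (1 / alpha))).
  assert (Hp : 0 < Rpower s (- (1 / alpha))) by apply exp_pos.
  assert (Ha : 0 < a) by (apply Rmult_lt_0_compat; lra).
  assert (HA : forall x, norm x <= 1 -> norm (ap A (T s x)) <= a).
  { intros x Hx. eapply Rle_trans; [apply (opnorm_le _ _ (HM s Hs) x Hx)|].
    apply Rmult_le_compat_r; lra. }
  split.
  - exists a. split; [lra|].
    apply (bound_of_unit_ball (fun x => ap A (T s x))); [|assumption].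
    apply composite_scal; [assumption|lra|]. intros x. apply Hdom. lra.
  - apply (bound_of_unit_ball (fun x => ap B (T s x))).
    { intros k x. apply (lin_scal (fun x => ap B (T s x))). apply compBT. lra. }
    intros x Hx. eapply Rle_trans; [apply Hsub, Hdom; lra|].
    assert (E : c * Rpower M1 theta * Rpower N (1 - theta) * Rpower s (- (theta / alpha)) =
      c * Rpower a theta * Rpower N (1 - theta)).
    { unfold a. rewrite <- (Rpower_mult_distr M1) by lra. rewrite Rpower_mult.
      replace (- (1 / alpha) * theta) with (- (theta / alpha)) by (field; lra). ring. }
    rewrite E. apply Rmult_le_compat; [|apply rpow_ge_0| |].
    + apply Rmult_le_pos; [lra|apply rpow_ge_0].
    + apply Rmult_le_compat_l; [lra|]. apply rpow_le; [assumption|assumption|now apply HA].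
    + apply rpow_le; [lra|lra|]. eapply Rle_trans; [apply Nb; lra|].
      pose proof (norm_ge_0 x). nra.
Qed.

(** * Expansion and telescoping of the difference of the semigroups *)

(** The time is split as r + r so that A T(r + r) x = T(r) A T(r) x is again in
    D(A), with A of it bounded by a^2 |x|. *)
Lemma first_order_difference {X : Banach} (A B : operator X) (S T : R -> X -> X) (r a e : R) :
  is_generator A T -> is_generator (perturbed A B) S ->
  (forall t x, 0 < t -> dom A (T t x)) ->
  (forall t, 0 < t -> compact_operator (fun x => ap B (T t x))) ->
  0 < r -> 0 <= a -> (forall x, norm (ap A (T r x)) <= a * norm x) -> 0 < e ->
  exists d, 0 < d /\ forall h x, 0 <= h < d ->
    norm (minus (minus (S h (T (r + r) x)) (T h (T (r + r) x))) (h *: ap B (T (r + r) x)))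
      <= e * h * norm x.
Proof.
  intros genA genAB Hdom compBT Hr Ha Ab He.
  destruct (linear_bound _ (proj1 (compBT r Hr))) as [b [Hb Bb]]. cbv beta in Bb.
  destruct (common_bound S T 1 (proj1 genAB) (proj1 genA)) as [M [HM [Sb Tb]]].
  destruct (semigroup_uniform_on_compact S _ (e / 2) (proj1 genAB)
    (compBT (r + r) ltac:(lra)) ltac:(lra)) as [d1 [Hd1 Hcomp]]. cbv beta in Hcomp.
  pose proof genA as [[_ [_ [Tadd _]]] _]. pose proof genAB as [[Slin _] _].
  set (Q := (M + 2) * (2 * a + b) * a).
  assert (HQ : 0 <= Q) by (unfold Q; repeat apply Rmult_le_pos; lra).
  set (d2 := e / (2 * (Q + 1))).
  assert (Hd2 : 0 < d2) by (apply Rdiv_lt_0_compat; lra).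
  assert (HdQ : Q * d2 <= e / 2).
  { replace (e / 2) with ((Q + 1) * d2) by (unfold d2; field; lra). nra. }
  exists (Rmin 1 (Rmin d1 d2)). split; [now repeat apply Rmin_glb_lt; try lra|].
  intros h x Hh.
  pose proof (Rmin_l 1 (Rmin d1 d2)). pose proof (Rmin_r 1 (Rmin d1 d2)).
  pose proof (Rmin_l d1 d2). pose proof (Rmin_r d1 d2).
  assert (Hx : 0 <= norm x) by apply norm_ge_0.
  set (z := ap A (T r x)). set (y := T (r + r) x).
  assert (Hz : norm z <= a * norm x) by apply Ab.
  assert (Hy : ap A y = T r z).
  { unfold y. rewrite Tadd by lra.
    apply (generator_semigroup A T r (T r x) genA); [lra|]. now apply Hdom. }
  assert (HyA : dom A y) by (apply Hdom; lra).
  assert (HAz : norm (ap A (T r z)) <= a * a * norm x).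
  { eapply Rle_trans; [apply Ab|]. nra. }
  assert (HABz : norm (plus (ap A (T r z)) (ap B (T r z))) <= (a + b) * a * norm x).
  { eapply Rle_trans; [apply (norm_triangle (V := X))|].
    specialize (Bb z). specialize (Ab (T r z)).
    assert (b * norm z <= b * (a * norm x)) by (apply Rmult_le_compat_l; lra).
    lra. }
  (* A y lies in D(A), where both orbits are Lipschitz at 0. *)
  assert (HT : norm (minus (minus (T h y) y) (h *: ap A y)) <=
    h * (h * ((M + 2) * (a * a * norm x)))).
  { apply (generator_remainder A T h M); try lra; try assumption.
    - now apply bounded_on_le with 1; [|lra].
    - intros q Hq. rewrite Hy.
      eapply Rle_trans; [apply (generator_lipschitz A T q M); try lra; try assumption|].
      + now apply bounded_on_le with 1; [|lra].
      + now apply Hdom.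
      + apply Rmult_le_compat; try lra.
        * apply Rmult_le_pos; [lra|apply norm_ge_0].
        * apply Rmult_le_compat_l; lra. }
  assert (HS : norm (minus (minus (S h y) y) (h *: plus (ap A y) (ap B y))) <=
    h * (h * ((M + 2) * ((a + b) * a * norm x)) + e / 2 * norm x)).
  { apply (generator_remainder (perturbed A B) S h M); try lra; try assumption.
    - now apply bounded_on_le with 1; [|lra].
    - intros q Hq. change (ap (perturbed A B) y) with (plus (ap A y) (ap B y)).
      rewrite (lin_plus (S q)) by (apply Slin; lra).
      replace (minus (plus (S q (ap A y)) (S q (ap B y))) (plus (ap A y) (ap B y))) with
        (plus (minus (S q (ap A y)) (ap A y)) (minus (S q (ap B y)) (ap B y))) by vector.
      eapply Rle_trans; [apply (norm_triangle (V := X))|].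
      apply Rplus_le_compat; [|apply Hcomp; lra].
      rewrite Hy.
      eapply Rle_trans; [apply (generator_lipschitz (perturbed A B) S q M);
        try lra; try assumption|].
      + now apply bounded_on_le with 1; [|lra].
      + now apply Hdom.
      + apply Rmult_le_compat; try lra.
        * apply Rmult_le_pos; [lra|apply norm_ge_0].
        * apply Rmult_le_compat_l; [lra|]. exact HABz. }
  replace (minus (minus (S h y) (T h y)) (h *: ap B y)) with
    (minus (minus (minus (S h y) y) (h *: plus (ap A y) (ap B y)))
       (minus (minus (T h y) y) (h *: ap A y))) by vector.
  eapply Rle_trans; [apply norm_minus_le|].
  assert (HQh : Q * h <= e / 2) by (apply Rle_trans with (Q * d2); nra).
  assert (HQx : Q * h * (h * norm x) <= e / 2 * (h * norm x)).
  { apply Rmult_le_compat_r; [|exact HQh]. apply Rmult_le_pos; lra. }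
  unfold Q in HQx. lra.
Qed.

(** The approximant [K] and its norm bound are produced together, since the same
    sum serves two purposes: its compactness for the final statement, its norm
    for the estimate near time 0. *)
Lemma difference_telescoped {X : Banach} (B : operator X) (S T : R -> X -> X)
  (M s t beta e : R) :
  is_C0_semigroup S -> is_C0_semigroup T ->
  0 < M -> bounded_on S t M -> bounded_on T t M -> 0 <= t -> 0 <= s -> 0 <= beta ->
  compact_operator (fun x => ap B (T s x)) ->
  (forall x, norm (ap B (T s x)) <= beta * norm x) ->
  (forall e, 0 < e -> exists d, 0 < d /\ forall h x, 0 <= h < d ->
    norm (minus (minus (S h (T s x)) (T h (T s x))) (h *: ap B (T s x))) <= e * h * norm x) ->
  0 < e ->
  exists K : X -> X, compact_operator K /\ (forall x, norm (K x) <= t * (M * M * beta) * norm x) /\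
    forall x, norm (minus (minus (S t (T s x)) (T t (T s x))) (K x)) <= e * norm x.
Proof.
  intros [Slin [S0 [Sadd _]]] [Tlin [T0 [Tadd _]]] HM Sb Tb Ht Hs Hbeta Bcomp Bb Hfo He.
  destruct (Req_dec t 0) as [->|Ht0].
  { exists (fun _ : X => zero : X). split; [apply compact_zero|]. split; intros x; cbv beta.
    - rewrite norm_null. lra.
    - rewrite S0, T0. replace (minus (minus (T s x) (T s x)) (zero : X)) with (zero : X) by vector.
      rewrite norm_null. apply Rmult_le_pos; [lra|apply (norm_ge_0 (V := X))]. }
  set (eta := e / (t * (M * M))).
  assert (HMM : 0 < t * (M * M)) by (repeat apply Rmult_lt_0_compat; lra).
  destruct (Hfo eta) as [d [Hd Hlim]]; [now apply Rdiv_lt_0_compat|].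
  destruct (INR_unbounded (t / d)) as [n0 Hn0].
  set (n := Datatypes.S n0). assert (Hn : 0 < INR n) by (apply lt_0_INR; lia).
  set (h := t / INR n).
  assert (Hh : 0 < h < d).
  { split; [apply Rdiv_lt_0_compat; lra|]. unfold h.
    apply Rmult_lt_reg_r with (INR n); [assumption|].
    replace (t / INR n * INR n) with (t / d * d) by (field; lra).
    rewrite Rmult_comm. apply Rmult_lt_compat_l; [assumption|].
    unfold n. rewrite S_INR. lra. }
  assert (Hnh : INR n * h = t) by (unfold h; field; lra).
  assert (Hk : forall k, (k <= n)%nat -> exists K : X -> X, compact_operator K /\
    (forall x, norm (K x) <= INR k * h * (M * M * beta) * norm x) /\
    forall x, norm (minus (minus (S t (T s x)) (S (t - INR k * h) (T (INR k * h) (T s x))))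
      (K x)) <= INR k * h * (M * M * eta) * norm x).
  { intros k. induction k as [|k IH]; intros Hkn.
    - exists (fun _ : X => zero : X). split; [apply compact_zero|]. cbn [INR]. split; intros x; cbv beta.
      + rewrite norm_null. lra.
      + rewrite Rmult_0_l, Rminus_0_r, T0.
        replace (minus (minus (S t (T s x)) (S t (T s x))) (zero : X)) with (zero : X) by vector.
        rewrite norm_null. lra.
    - destruct (IH ltac:(lia)) as [K [Kcomp [Kb Kdiff]]]. clear IH.
      assert (Hkh : 0 <= INR k * h <= t - h).
      { split; [pose proof (pos_INR k); nra|].
        apply le_INR in Hkn. rewrite S_INR in Hkn. nra. }
      rewrite S_INR. set (q := INR k * h) in *.
      replace ((INR k + 1) * h) with (q + h) by (unfold q; ring).
      set (p := t - (q + h)).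
      assert (Hp : 0 <= p <= t) by (unfold p; lra).
      exists (fun x => plus (K x) (h *: S p (ap B (T s (T q x))))). split; [|split].
      + apply compact_plus; [assumption|].
        apply (compact_comp (fun v => h *: S p v) (fun x => ap B (T s x)) (T q));
          [|assumption|apply Tlin; lra].
        apply (is_linear_comp (S p) (fun v => h *: v)); [apply Slin; lra|].
        apply (is_linear_scal_r (V := X)). intros u v. apply Cmult_comm.
      + intros x. eapply Rle_trans; [apply (norm_triangle (V := X))|].
        rewrite norm_rscal_pos by lra.
        assert (H1 : norm (S p (ap B (T s (T q x)))) <= M * (beta * (M * norm x))).
        { eapply Rle_trans; [apply Sb, Hp|]. apply Rmult_le_compat_l; [lra|].
          eapply Rle_trans; [apply Bb|]. apply Rmult_le_compat_l; [lra|].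
          apply Tb. lra. }
        pose proof (Rmult_le_compat_l h _ _ ltac:(lra) H1).
        specialize (Kb x). lra.
      + intros x. set (y := T q x).
        replace (T (q + h) (T s x)) with (T h (T s y))
          by (unfold y; rewrite <- !Tadd by lra; f_equal; ring).
        specialize (Kdiff x).
        replace (T q (T s x)) with (T s y) in Kdiff
          by (unfold y; rewrite <- !Tadd by lra; f_equal; ring).
        replace (t - q) with (p + h) in Kdiff by (unfold p; ring).
        rewrite Sadd in Kdiff by lra.
        set (u := S p (S h (T s y))) in *.
        replace (minus (minus (S t (T s x)) (S p (T h (T s y))))
          (plus (K x) (h *: S p (ap B (T s y))))) with
          (plus (minus (minus (S t (T s x)) u) (K x))
            (minus (minus u (S p (T h (T s y)))) (h *: S p (ap B (T s y))))) by vector.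
        unfold u at 2.
        eapply Rle_trans; [apply (norm_triangle (V := X))|].
        assert (Hpl : is_linear (S p)) by (apply Slin; lra).
        rewrite <- (lin_rscal _ Hpl), <- !(lin_minus _ Hpl).
        pose proof (Sb p (minus (minus (S h (T s y)) (T h (T s y))) (h *: ap B (T s y))) Hp) as H1.
        pose proof (Hlim h y ltac:(lra)) as H2.
        assert (Heta : 0 < eta) by now apply Rdiv_lt_0_compat.
        assert (H3 : eta * h * norm y <= eta * h * (M * norm x)).
        { apply Rmult_le_compat_l; [apply Rmult_le_pos; lra|]. apply Tb. lra. }
        pose proof (Rmult_le_compat_l M _ _ ltac:(lra) (Rle_trans _ _ _ H2 H3)) as H4.
        lra. }
  destruct (Hk n (Nat.le_refl n)) as [K [Kcomp [Kb Kdiff]]]. rewrite Hnh in Kb, Kdiff.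
  exists K. split; [assumption|]. split; [assumption|].
  intros x. specialize (Kdiff x). rewrite Rminus_diag, S0 in Kdiff.
  replace e with (t * (M * M * eta)) by (unfold eta; field; lra). exact Kdiff.
Qed.

(** Dyadic telescoping of s |-> S(t - s) T(s).  The increment over [s, 2s] is at
    most M C s^sigma |x|, which is |x| (w(2s) - w(s)) for w(s) = D s^sigma with
    the D chosen below; thus the geometric series is summed by its own primitive. *)
Lemma difference_vanishes {X : Banach} (S T : R -> X -> X) (d C sigma : R) :
  is_C0_semigroup S -> is_C0_semigroup T -> 0 < d -> 0 < C -> 0 < sigma ->
  (forall s x, 0 < s < d ->
    norm (minus (S s (T s x)) (T s (T s x))) <= C * Rpower s sigma * norm x) ->
  forall e, 0 < e -> exists d', 0 < d' /\ forall t x, 0 < t < d' ->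
    norm (minus (S t x) (T t x)) <= e * norm x.
Proof.
  intros HS HT Hd HC Hsigma Hdiff e He.
  destruct (common_bound S T d HS HT) as [M [HM [Sb Tb]]].
  destruct HS as [Slin [S0 [Sadd Scont]]]. destruct HT as [_ [T0 [Tadd Tcont]]].
  assert (H2 : 1 < Rpower 2 sigma).
  { rewrite <- (Rpower_O 2) by lra. apply Rpower_lt; lra. }
  (* D (2^sigma - 1) = M C makes the increments of D s^sigma dominate. *)
  set (D := M * C / (Rpower 2 sigma - 1)).
  assert (HMC : 0 < M * C) by nra.
  assert (HD : 0 < D) by (apply Rdiv_lt_0_compat; lra).
  assert (HDeq : D * (Rpower 2 sigma - 1) = M * C) by (unfold D; field; lra).
  assert (HeD : 0 < e / D) by now apply Rdiv_lt_0_compat.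
  exists (Rmin d (Rpower (e / D) (/ sigma))). split.
  { apply Rmin_glb_lt; [assumption|apply exp_pos]. }
  intros t x Ht.
  pose proof (Rmin_l d (Rpower (e / D) (/ sigma))).
  pose proof (Rmin_r d (Rpower (e / D) (/ sigma))).
  assert (Hx : 0 <= norm x) by apply norm_ge_0.
  assert (Hw : D * Rpower t sigma <= e).
  { replace e with (D * (e / D)) by (field; lra).
    apply Rmult_le_compat_l; [lra|].
    rewrite <- (Rpower_1 (e / D)) by assumption.
    replace 1 with (/ sigma * sigma) by (field; lra).
    rewrite <- Rpower_mult. apply Rle_Rpower_l; lra. }
  assert (Hn : forall n : nat,
    norm (minus (S (t - t / 2 ^ n) (T (t / 2 ^ n) x)) (T t x)) <=
      D * (Rpower t sigma - Rpower (t / 2 ^ n) sigma) * norm x).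
  { intros n. induction n as [|n IH].
    - cbn [pow]. replace (t / 1) with t by field. rewrite Rminus_diag, S0.
      replace (minus (T t x) (T t x)) with (zero : X) by vector.
      rewrite norm_null. lra.
    - set (s := t / 2 ^ Datatypes.S n).
      assert (Hpn : 1 <= 2 ^ n) by (apply pow_R1_Rle; lra).
      replace (t / 2 ^ n) with (s + s) in IH
        by (unfold s; cbn [pow]; field; apply pow_nonzero; lra).
      assert (Hs : 0 < s).
      { apply Rdiv_lt_0_compat; [lra|apply pow_lt; lra]. }
      assert (Hst : s + s <= t).
      { replace (s + s) with (t * / 2 ^ n)
          by (unfold s; cbn [pow]; field; apply pow_nonzero; lra).
        rewrite <- (Rmult_1_r t) at 2. apply Rmult_le_compat_l; [lra|].
        rewrite <- Rinv_1. apply Rinv_le_contravar; lra. }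
      eapply Rle_trans; [apply (norm_minus_trans (S (t - (s + s)) (T (s + s) x)))|].
      replace (t - s) with ((t - (s + s)) + s) by ring.
      rewrite Sadd, Tadd in * by lra.
      rewrite <- (lin_minus (S (t - (s + s)))) by (apply Slin; lra).
      pose proof (Sb (t - (s + s)) (minus (S s (T s x)) (T s (T s x))) ltac:(lra)) as H3.
      pose proof (Rmult_le_compat_l M _ _ ltac:(lra) (Hdiff s x ltac:(lra))) as H4.
      replace (s + s) with (2 * s) in IH by ring.
      rewrite <- Rpower_mult_distr in IH by lra.
      assert (H5 : M * C * Rpower s sigma * norm x =
        D * (Rpower 2 sigma - 1) * Rpower s sigma * norm x) by now rewrite HDeq.
      replace (2 * s) with (s + s) in IH by ring. lra. }
  apply Rle_trans with (D * Rpower t sigma * norm x);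
    [|now apply Rmult_le_compat_r].
  apply (le_of_le_plus_eps _ _ (2 * M)); [lra|]. intros eta Heta.
  destruct (proj1 (limit_at_right_0 _ _) (Scont x) eta Heta) as [d1 [Hd1 Hlim1]].
  destruct (proj1 (limit_at_right_0 _ _) (Tcont x) eta Heta) as [d2 [Hd2 Hlim2]].
  assert (Hm : 0 < Rmin d1 d2) by now apply Rmin_glb_lt.
  pose proof (Rmin_l d1 d2). pose proof (Rmin_r d1 d2).
  destruct (pow_lt_1_zero (/ 2) ltac:(rewrite Rabs_pos_eq; lra) (Rmin d1 d2 / t)) as [n Hpn];
    [apply Rdiv_lt_0_compat; lra|].
  specialize (Hpn n (Nat.le_refl n)). rewrite Rabs_pos_eq in Hpn by (apply pow_le; lra).
  specialize (Hn n). set (s := t / 2 ^ n) in *.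
  assert (Hpow : 1 <= 2 ^ n) by (apply pow_R1_Rle; lra).
  assert (Hs : 0 < s <= t).
  { split; [apply Rdiv_lt_0_compat; [lra|apply pow_lt; lra]|].
    unfold s, Rdiv. rewrite <- (Rmult_1_r t) at 2. apply Rmult_le_compat_l; [lra|].
    rewrite <- Rinv_1. apply Rinv_le_contravar; lra. }
  assert (Hsd : s < Rmin d1 d2).
  { unfold s, Rdiv. rewrite <- pow_inv.
    replace (Rmin d1 d2) with (t * (Rmin d1 d2 / t)) by (field; lra).
    apply Rmult_lt_compat_l; lra. }
  (* T(s) x and S(s) x are both close to x, for this fixed x only. *)
  assert (Hsplit : norm (minus (S t x) (S (t - s) (T s x))) <= M * (eta + eta)).
  { replace t with ((t - s) + s) at 1 by ring. rewrite Sadd by lra.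
    rewrite <- (lin_minus (S (t - s))) by (apply Slin; lra).
    eapply Rle_trans; [apply Sb; lra|]. apply Rmult_le_compat_l; [lra|].
    eapply Rle_trans; [apply (norm_minus_trans x)|].
    rewrite (norm_minus_sym x (T s x)).
    apply Rplus_le_compat; apply Rlt_le; [apply Hlim1|apply Hlim2]; lra. }
  eapply Rle_trans; [apply (norm_minus_trans (S (t - s) (T s x)))|].
  assert (0 <= D * Rpower s sigma * norm x).
  { apply Rmult_le_pos; [|assumption]. apply Rmult_le_pos; [lra|]. apply Rlt_le, exp_pos. }
  lra.
Qed.

(** The constants [d] and [C] do not depend on [s], which is what makes the power
    of [s] meaningful as [s] tends to 0. *)
Lemma perturbation_telescoped {X : Banach} (A B : operator X) (S T : R -> X -> X)
  (alpha theta : R) :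
  is_generator A T -> is_generator (perturbed A B) S -> crandall_pazy A T alpha ->
  subordinate B A theta -> 0 < theta ->
  (forall t, 0 < t -> compact_operator (fun x => ap B (T t x))) ->
  exists d C, 0 < d /\ 0 < C /\ forall s t M e, 0 < s < d -> 0 <= t -> 0 < M ->
    bounded_on S t M -> bounded_on T t M -> 0 < e ->
    exists K : X -> X, compact_operator K /\
      (forall x, norm (K x) <= t * (M * M * (C * Rpower s (- (theta / alpha)))) * norm x) /\
      forall x, norm (minus (minus (S t (T s x)) (T t (T s x))) (K x)) <= e * norm x.
Proof.
  intros genA genAB cpT subB Htheta compBT.
  destruct (crandall_pazy_bounds A B T alpha theta genA cpT subB Htheta compBT)
    as [d [C [Hd [HC Hb]]]].
  exists d, C. split; [assumption|]. split; [assumption|].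
  intros s t M e Hs Ht HM Sb Tb He.
  destruct (Hb (s / 2) ltac:(lra)) as [[a [Ha Ab]] _].
  apply (difference_telescoped B); try assumption; try lra.
  - apply genAB.
  - apply genA.
  - apply Rlt_le, Rmult_lt_0_compat; [assumption|apply exp_pos].
  - apply compBT. lra.
  - apply (Hb s Hs).
  - intros e' He'. replace s with (s / 2 + s / 2) by field.
    apply (first_order_difference A B S T (s / 2) a e'); try assumption; try lra.
    apply generator_immediate; [assumption|]. apply cpT.
Qed.

(** Splitting off a short time s: S(t-s) (S(s) - T(s)) is small in norm by
    [difference_vanishes], and (S(t-s) - T(t-s)) T(s) is approximated by compact
    operators.  The norm estimate that [difference_vanishes] asks for is the one on
    the compact approximant at time t = s, as s * s^(-theta/alpha) = s^sigma. *)
Lemma difference_near_compact {X : Banach} (A B : operator X) (S T : R -> X -> X)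
  (alpha theta : R) :
  is_generator A T -> is_generator (perturbed A B) S -> crandall_pazy A T alpha ->
  subordinate B A theta -> 0 < theta < alpha ->
  (forall t, 0 < t -> compact_operator (fun x => ap B (T t x))) ->
  forall t e, 0 < t -> 0 < e -> exists K : X -> X, compact_operator K /\
    forall x, norm (minus (minus (S t x) (T t x)) (K x)) <= e * norm x.
Proof.
  intros genA genAB cpT subB Htheta compBT t e Ht He.
  destruct (perturbation_telescoped A B S T alpha theta genA genAB cpT subB
    (proj1 Htheta) compBT) as [d [C [Hd [HC Htel]]]].
  set (sigma := 1 - theta / alpha).
  assert (Hsigma : 0 < sigma).
  { unfold sigma. assert (theta / alpha < 1); [|lra].
    apply Rmult_lt_reg_r with alpha; [lra|].
    replace (theta / alpha * alpha) with theta by (field; lra). lra. }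
  destruct (common_bound S T d (proj1 genAB) (proj1 genA)) as [N [HN [SN TN]]].
  destruct (common_bound S T t (proj1 genAB) (proj1 genA)) as [M [HM [SM TM]]].
  assert (Hvanish : exists d', 0 < d' /\ forall s x, 0 < s < d' ->
    norm (minus (S s x) (T s x)) <= e / (2 * M) * norm x).
  { apply (difference_vanishes S T d (N * N * C) sigma (proj1 genAB) (proj1 genA) Hd);
      [|assumption| |now apply Rdiv_lt_0_compat; lra].
    - repeat apply Rmult_lt_0_compat; lra.
    - intros s x Hs. apply (le_of_le_plus_eps _ _ (norm x)); [apply norm_ge_0|].
      intros eta Heta.
      destruct (Htel s s N eta Hs) as [K [_ [Kb Kdiff]]]; try lra.
      { now apply bounded_on_le with d; [|lra]. }
      { now apply bounded_on_le with d; [|lra]. }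
      specialize (Kb x). specialize (Kdiff x).
      replace (N * N * C * Rpower s sigma) with
        (s * (N * N * (C * Rpower s (- (theta / alpha))))).
      + replace (minus (S s (T s x)) (T s (T s x))) with
          (plus (minus (minus (S s (T s x)) (T s (T s x))) (K x)) (K x)) by vector.
        eapply Rle_trans; [apply (norm_triangle (V := X))|]. lra.
      + unfold sigma, Rminus. rewrite Rpower_plus, Rpower_1 by lra. ring. }
  destruct Hvanish as [d' [Hd' Hvanish]].
  set (s := Rmin (t / 2) (Rmin (d / 2) (d' / 2))).
  assert (Hs : 0 < s <= t / 2 /\ s <= d / 2 /\ s <= d' / 2).
  { pose proof (Rmin_l (t / 2) (Rmin (d / 2) (d' / 2))).
    pose proof (Rmin_r (t / 2) (Rmin (d / 2) (d' / 2))).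
    pose proof (Rmin_l (d / 2) (d' / 2)). pose proof (Rmin_r (d / 2) (d' / 2)).
    unfold s. repeat split; try lra. repeat apply Rmin_glb_lt; lra. }
  destruct (Htel s (t - s) M (e / 2)) as [K [Kcomp [_ Kdiff]]]; try lra.
  { now apply bounded_on_le with t; [|lra]. }
  { now apply bounded_on_le with t; [|lra]. }
  exists K. split; [assumption|]. intros x.
  pose proof genAB as [[Slin [_ [Sadd _]]] _]. pose proof genA as [[_ [_ [Tadd _]]] _].
  replace t with ((t - s) + s) by ring. rewrite Sadd, Tadd by lra.
  replace (minus (minus (S (t - s) (S s x)) (T (t - s) (T s x))) (K x)) with
    (plus (minus (S (t - s) (S s x)) (S (t - s) (T s x)))
      (minus (minus (S (t - s) (T s x)) (T (t - s) (T s x))) (K x))) by vector.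
  eapply Rle_trans; [apply (norm_triangle (V := X))|].
  rewrite <- (lin_minus (S (t - s))) by (apply Slin; lra).
  pose proof (SM (t - s) (minus (S s x) (T s x)) ltac:(lra)) as H1.
  pose proof (Rmult_le_compat_l M _ _ ltac:(lra) (Hvanish s x ltac:(lra))) as H2.
  replace (M * (e / (2 * M) * norm x)) with (e / 2 * norm x) in H2 by (field; lra).
  specialize (Kdiff x). lra.
Qed.

Theorem corollary1 (X : CompleteNormedModule C_AbsRing)
  (A B : operator X) (T S : R -> X -> X) (alpha theta : R)
  (genA : is_generator A T)
  (qcT : quasi_compact T)
  (cpT : crandall_pazy A T alpha)
  (linB : is_linear_operator B)
  (theta_alpha : (0 < theta < alpha)%R /\ (alpha <= 1)%R)
  (subB : subordinate B A theta)
  (compBT : forall t : R, (0 < t)%R -> compact_operator (fun x => ap B (T t x)))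
  (genAB : is_generator (perturbed A B) S) :
  quasi_compact S.
Proof.
  apply is_lim_spec. intros e. apply is_lim_spec in qcT.
  destruct (qcT (mkposreal (e / 3) ltac:(pose proof (cond_pos e); lra))) as [t0 Ht0].
  cbn [pos] in Ht0. pose proof (cond_pos e) as He.
  exists (Rmax 0 t0). intros t Ht.
  pose proof (Rmax_l 0 t0). pose proof (Rmax_r 0 t0).
  specialize (Ht0 t ltac:(lra)).
  destruct (dist_to_compact_lt (T t) (e / 3)) as [K [r [Kcomp [Hr HK]]]].
  { apply genA. lra. }
  { pose proof (Rle_abs (dist_to_compact (T t) - 0)). lra. }
  destruct (difference_near_compact A B S T alpha theta genA genAB cpT subB
    (proj1 theta_alpha) compBT t (e / 3) ltac:(lra) ltac:(lra)) as [K' [K'comp HK']].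
  destruct (dist_to_compact_bounds (S t) (fun x => plus (K x) (K' x)) (2 * (e / 3)))
    as [Hge Hle].
  - now apply compact_plus.
  - lra.
  - intros x.
    replace (minus (S t x) (plus (K x) (K' x))) with
      (plus (minus (T t x) (K x)) (minus (minus (S t x) (T t x)) (K' x))) by vector.
    eapply Rle_trans; [apply (norm_triangle (V := X))|].
    specialize (HK x). specialize (HK' x).
    assert (r * norm x <= e / 3 * norm x).
    { apply Rmult_le_compat_r; [apply (norm_ge_0 (V := X))|lra]. }
    lra.
  - rewrite Rminus_0_r, Rabs_pos_eq; lra.
Qed.
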